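(* Suppose investment costs are $\beta\, C^I(q,\theta)$ with a scale parameter $\beta\ge0$. For each $\theta\in[0,1)$, the optimal symmetric quality $q^*_{sym}(\theta)$ is (weakly) decreasing in the number of firms $n$ and in $\beta$.
   Context: Setting. There are $n$ firms with types $\theta_i\in[0,1]$, i.i.d. with cdf $F$ and strictly positive density $f$. $V:\mathbb R_+\to\mathbb R$ is the buyer's value of quality; $C^P,C^I:\mathbb R_+\times[0,1]\to\mathbb R_+$ are production (winner-pay) and (unscaled) investment (all-pay) costs; all functions are as smooth as needed. Virtual costs: $\tilde C^P=C^P+C^P_\theta F/f$, $\tilde C^I=C^I+C^I_\theta F/f$ (subscripts denote partial derivatives). Standing assumptions. For $q>0$, $\theta\in(0,1)$: $C^P_q,C^P_\theta,C^I_q,C^I_\theta,C^P_{q\theta},C^I_{q\theta}>0$; $C^I(0,\theta)=C^I_q(0,\theta)=0$; $V'\ge0$, $V''\le0$; $\tilde C^P_\theta>0$, $\tilde C^P_{qq}>0$, $\tilde C^P_{q\theta}\ge0$, $\tilde C^I_\theta>0$, $\tilde C^I_{qq}>0$, $\tilde C^I_{q\theta}\ge0$. For every $\theta\in[0,1]$ and every value of $\beta$ considered: $V'(0)>\tilde C^P_q(0,\theta)$, and $V'(q)<\tilde C^P_q(q,\theta)+\beta\tilde C^I_q(q,\theta)$ for all large $q$. The optimal symmetric quality function $q^*_{sym}$ (depending on $n,\beta$) is given by: $q^*_{sym}(\theta)$ maximizes over $q\ge0$ $$V(q)-\tilde C^P(q,\theta)-\frac{\beta}{(1-F(\theta))^{n-1}}\tilde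 C^I(q,\theta).$$
   Formalization: The optimal symmetric quality function is additionally required to be right-continuous at θ=0, since the assumptions on (0,1) allow several maximizers at θ=0 and an arbitrary choice among them need not be monotone in n or β. *)

(* Defs.v *)
From HB Require Import structures.
From mathcomp Require Import all_boot all_order all_algebra.
From mathcomp Require Import all_classical all_reals all_analysis.

Set Implicit Arguments.
Unset Strict Implicit.
Unset Printing Implicit Defensive.

Import Order.TTheory GRing.Theory Num.Theory.
Import numFieldNormedType.Exports.

Local Open Scope classical_set_scope.
Local Open Scope ring_scope.

Section Calculus.
Variable R : realType.
Implicit Types (A : set R) (g : R -> R) (h : R -> R -> R) (x q t : R).

(* Functions on R_+ or [0,1] are represented by total functions whose values
   outside the domain are irrelevant.  Derivatives are therefore taken within
   the domain: the ordinary derivative at interior points, the one-sided one at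
   the endpoints. *)
Definition difference_quotient g x : R -> R := fun y => (g y - g x) / (y - x).

Definition derivable_in A g x : Prop :=
  cvg (difference_quotient g x y @[y --> within A x^']).

Definition derive_in A g x : R :=
  lim (difference_quotient g x y @[y --> within A x^']).

Fixpoint Ck1 A (k : nat) g : Prop :=
  {within A, continuous g} /\
  (if k is k'.+1 then
     (forall x, A x -> derivable_in A g x) /\ Ck1 A k' (derive_in A g)
   else True).

Definition Rplus : set R := `[0, +oo[%classic.
Definition types : set R := `[0, 1]%classic.

Definition D (g : R -> R) : R -> R := derive_in Rplus g.

(* Partial derivatives of h(q, theta) on R_+ x [0,1]; D_qt is the subscript
   q theta: first in q, then in theta. *)
Definition D_q h : R -> R -> R := fun q t => derive_in Rplus (h^~ t) q.
Definition D_t h : R -> R -> R := fun q t => derive_in types (h q) t.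
Definition D_qq h := D_q (D_q h).
Definition D_qt h := D_t (D_q h).

Fixpoint Ck2 (k : nat) h : Prop :=
  {within Rplus `*` types, continuous (fun z : R * R => h z.1 z.2)} /\
  (if k is k'.+1 then
     (forall q t : R, Rplus q -> types t ->
        derivable_in Rplus (h^~ t) q /\ derivable_in types (h q) t) /\
     Ck2 k' (D_q h) /\ Ck2 k' (D_t h)
   else True).

End Calculus.

Section Model.
Variable R : realType.
Implicit Types (V F f : R -> R) (C CP CI : R -> R -> R) (B : set R).

Record type_distribution F f : Prop := TypeDistribution {
  density_smooth : Ck1 (@types R) 1 f;
  density_gt0 : forall t : R, 0 <= t <= 1 -> 0 < f t;
  cdf_density : forall t : R, 0 <= t <= 1 ->
    F t = \int[lebesgue_measure]_(x in `[0, t]) f x;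
  cdf_total : F 1 = 1 }.

Definition virtual C F f : R -> R -> R :=
  fun q t => C q t + D_t C q t * (F t / f t).

(* Assumptions on a cost function shared by production and investment. The
   class C^3 is what the third-order terms of the virtual cost require. *)
Record cost_assumptions C F f : Prop := CostAssumptions {
  cost_smooth : Ck2 3 C;
  cost_ge0 : forall q t : R, 0 <= q -> 0 <= t <= 1 -> 0 <= C q t;
  cost_q : forall q t : R, 0 < q -> 0 < t < 1 -> 0 < D_q C q t;
  cost_t : forall q t : R, 0 < q -> 0 < t < 1 -> 0 < D_t C q t;
  cost_qt : forall q t : R, 0 < q -> 0 < t < 1 -> 0 < D_qt C q t;
  virtual_t : forall q t : R, 0 < q -> 0 < t < 1 -> 0 < D_t (virtual C F f) q t;
  virtual_qq : forall q t : R, 0 < q -> 0 < t < 1 -> 0 < D_qq (virtual C F f) q t;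
  virtual_qt : forall q t : R, 0 < q -> 0 < t < 1 ->
    0 <= D_qt (virtual C F f) q t }.

(* B is the set of values of the scale parameter under consideration. *)
Record standing_assumptions V CP CI F f B : Prop := StandingAssumptions {
  types_distr : type_distribution F f;
  value_smooth : Ck1 (@Rplus R) 2 V;
  value_D : forall q : R, 0 < q -> 0 <= D V q;
  value_DD : forall q : R, 0 < q -> D (D V) q <= 0;
  production : cost_assumptions CP F f;
  investment : cost_assumptions CI F f;
  investment_0 : forall t : R, 0 < t < 1 -> CI 0 t = 0 /\ D_q CI 0 t = 0;
  scale_ge0 : forall b : R, B b -> 0 <= b;
  marginal_0 : forall t : R, 0 <= t <= 1 -> D_q (virtual CP F f) 0 t < D V 0;
  marginal_oo : forall b t : R, B b -> 0 <= t <= 1 ->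
    \forall q \near +oo,
      D V q < D_q (virtual CP F f) q t + b * D_q (virtual CI F f) q t }.

Definition sym_objective V CP CI F f (n : nat) (b t q : R) : R :=
  V q - virtual CP F f q t - b / (1 - F t) ^+ n.-1 * virtual CI F f q t.

(* For t in (0,1) the objective is strictly concave and its maximizer unique.
   At t = 0 the assumptions only give weak concavity, and pointwise
   maximization may leave a tie; continuity of the quality function at that
   endpoint resolves it (and holds automatically when there is no tie). *)
Definition is_qsym V CP CI F f (n : nat) (b : R) (qs : R -> R) : Prop :=
  (forall t : R, 0 <= t < 1 ->
     0 <= qs t /\
     forall q : R, 0 <= q ->
       sym_objective V CP CI F f n b t q
         <= sym_objective V CP CI F f n b t (qs t)) /\
  qs t @[t --> 0^'+] --> qs 0.

End Model.

(* Main.v *)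
(* Write the objective as V - P - w I, where P and I are the virtual costs and
   the weight w = b / (1 - F)^(n-1) increases with both n and b.  Adding the two
   optimality conditions for weights v < w shows that a larger maximizer for w
   would have no larger I; but I is strictly convex and nonnegative with
   I(0) = 0, hence strictly increasing.  For v = w, strict concavity of the
   objective makes the maximizer unique.  This covers interior types, and the
   type 0 follows by letting t tend to 0. *)
Require Import Defs.
From mathcomp Require Import all_boot all_order all_algebra.
From mathcomp Require Import all_classical all_reals all_analysis.
From mathcomp Require Import ring lra.

Set Implicit Arguments.
Unset Strict Implicit.
Unset Printing Implicit Defensive.

Import Order.TTheory GRing.Theory Num.Theory.
Import numFieldNormedType.Exports.
Local Open Scope classical_set_scope.
Local Open Scope ring_scope.

(** * Derivatives within a domain and ordinary derivatives *)

Section WithinDerivative.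
Context {R : realType}.
Implicit Types (A : set R) (g : R -> R) (x l : R).

(** At an interior point of [A] the restriction to [A] costs nothing, so the derivative within the
    domain is the ordinary one there. *)
Lemma within_dnbhs_nbhs A x : nbhs x A -> within A x^' = x^'.
Proof.
move=> Ax; rewrite eqEsubset; split=> S; last by apply: cvg_within.
rewrite /within/= => SA.
by apply: filterS2 Ax SA => y Ay Sy yx; exact: Sy yx Ay.
Qed.

Lemma cvg_addr_dnbhs a x : (h + x) @[h --> a^'] --> (a + x)^'.
Proof.
have ax : (h + x) @[h --> a] --> a + x.
  by apply: cvgD; [exact: cvg_id|exact: cvg_cst].
move=> S /ax; rewrite /dnbhs !nbhs_simpl /within/= => SA.
by apply: filterS SA => h Sh ha; apply: Sh; rewrite (inj_eq (addIr x)).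
Qed.

(** [is_derive] uses the quotient in the increment [h]; the substitution [y = h + x] turns either
    quotient into the other, and translations preserve punctured neighbourhoods. *)
Lemma difference_quotient_is_derive g x l :
  difference_quotient g x y @[y --> x^'] --> l <-> is_derive x 1 g l.
Proof.
split=> [gl|[/cvg_ex[/= k gk] gl]].
  have gl0 : h^-1 *: (g (h *: 1 + x) - g x) @[h --> 0^'] --> l.
    have sx := @cvg_addr_dnbhs 0 x; rewrite add0r in sx.
    rewrite (_ : (fun h => _) = difference_quotient g x \o +%R^~ x).
      exact: cvg_comp sx gl.
    by apply/funext => h; rewrite /difference_quotient/= addrK scaler1 mulrC.
  split; last exact/cvg_lim.
  by apply/cvg_ex; exists l.
have {}gl : k = l by rewrite -gl; apply/esym/cvg_lim.
rewrite gl {gl k} in gk.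
have sx := @cvg_addr_dnbhs x (- x); rewrite subrr in sx.
have := cvg_comp _ _ sx gk; rewrite (_ : _ \o _ = difference_quotient g x)//.
by apply/funext => h; rewrite /difference_quotient/= scaler1 subrK mulrC.
Qed.

Lemma derivable_in_is_derive A g x : nbhs x A ->
  derivable_in A g x -> is_derive x 1 g (derive_in A g x).
Proof.
move=> Ax; rewrite /derivable_in /derive_in within_dnbhs_nbhs// => gx.
exact/difference_quotient_is_derive.
Qed.

Lemma is_derive_derive_in A g x l : nbhs x A ->
  is_derive x 1 g l -> derive_in A g x = l.
Proof.
move=> Ax /difference_quotient_is_derive gx.
by rewrite /derive_in within_dnbhs_nbhs//; exact/cvg_lim.
Qed.

End WithinDerivative.

(** * Convexity and maximizers on the half-line *)

Section ConvexOnRplus.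
Context {R : realType}.
Implicit Types (g : R -> R) (a b c x : R).

Lemma nbhs_Rplus x : 0 < x -> nbhs x (@Rplus R).
Proof.
move=> x0; near=> y; rewrite /Rplus /= in_itv/= andbT.
by near: y; exact: (lt_le_nbhsr x0).
Unshelve. all: by end_near. Qed.

(** Continuity reaches the endpoint 0 while derivatives are asked only at positive points: this is
    what the mean value theorem on [[0, x]] consumes. *)
Definition twice_derivable g : Prop :=
  {within @Rplus R, continuous g} /\
  forall x, 0 < x ->
    is_derive x 1 g (D g x) /\ is_derive x 1 (D g) (D (D g) x).

Lemma twice_derivable_Ck1 g : Ck1 (@Rplus R) 2 g -> twice_derivable g.
Proof.
move=> [cg [dg [_ [dDg _]]]]; split=> // x x0.
have Rx := nbhs_Rplus x0; have Rx' := nbhs_singleton Rx.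
by split; apply: derivable_in_is_derive => //; [exact: dg|exact: dDg].
Qed.

(* The mean value theorem on [a, x] and [x, b], and then for g' between the two
   points found: consecutive slopes differ by a positive multiple of a value of
   g''. *)
Lemma slopes_twice_derivable g a x b : twice_derivable g ->
  0 <= a -> a < x -> x < b ->
  exists s e c, [/\ 0 < e, 0 < c, g x - g a = s * (x - a) &
    g b - g x = (s + D (D g) c * e) * (b - x)].
Proof.
move=> [cg dg] a0 ax xb.
have mvt u v : 0 <= u -> u < v ->
    exists2 c, c \in `]u, v[ & g v - g u = D g c * (v - u).
  move=> u0 uv; apply: MVT => // [y|].
    rewrite in_itv/= => /andP[uy _].
    by apply: (dg y _).1; exact: le_lt_trans uy.
  apply: continuous_subspaceW cg => y /=; rewrite /Rplus /= !in_itv/= andbT.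
  by case/andP => uy _; exact: le_trans uy.
have [p + gxa] := mvt a x a0 ax; rewrite in_itv/= => /andP[ap px].
have [q + gbx] := mvt x b (ltW (le_lt_trans a0 ax)) xb.
rewrite in_itv/= => /andP[xq qb].
have p0 : 0 < p by exact: le_lt_trans ap.
have pq : p < q by exact: lt_trans xq.
have [||c + Dqp] := @MVT _ (D g) (D (D g)) p q pq.
- move=> y; rewrite in_itv/= => /andP[py _].
  by apply: (dg y _).2; exact: lt_trans py.
- apply: derivable_within_continuous => y; rewrite in_itv/= => /andP[py _].
  by apply: ex_derive; apply: (dg y _).2; exact: lt_le_trans py.
rewrite in_itv/= => /andP[pc cq].
exists (D g p), (q - p), c; split; rewrite ?subr_gt0//.
  exact: lt_trans pc.
by rewrite -Dqp addrCA subrr addr0.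
Qed.

(** This is the shape of a virtual cost at a fixed type, with [k] standing for [F t / f t]. *)
Lemma twice_derivableDM g h k : twice_derivable g -> twice_derivable h ->
  twice_derivable (fun q => g q + h q * k).
Proof.
move=> [cg dg] [ch dh].
have dgh p r x : is_derive x 1 p (D p x) -> is_derive x 1 r (D r x) ->
    is_derive x 1 (fun q => p q + r q * k) (D p x + D r x * k).
  move=> px rx; apply: is_derive_eq.
  by rewrite scaler0 add0r [_ *: _]mulrC.
have D1 x : 0 < x -> D (fun q => g q + h q * k) x = D g x + D h x * k.
  move=> x0; apply: is_derive_derive_in; first exact: nbhs_Rplus.
  by apply: dgh; [exact: (dg x x0).1|exact: (dh x x0).1].
split=> [x|x x0]; first by apply: cvgD; [exact: cg|apply: cvgMl; exact: ch].
rewrite D1//; split.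
  by apply: dgh; [exact: (dg x x0).1|exact: (dh x x0).1].
have D2 : is_derive x 1 (D (fun q => g q + h q * k))
    (D (D g) x + D (D h) x * k).
  (* The formula [D1] holds only at positive points, hence near [x] rather than everywhere. *)
  apply: (@near_eq_is_derive _ _ _ (fun q => D g q + D h q * k)).
    by near=> y; rewrite D1//; near: y; exact: lt_nbhsr.
  by apply: dgh; [exact: (dg x x0).2|exact: (dh x x0).2].
by rewrite [D (D _) x](is_derive_derive_in (nbhs_Rplus x0) D2).
Unshelve. all: by end_near. Qed.

Lemma twice_derivable_Ck2 k (h : R -> R -> R) t : types t ->
  Ck2 k.+2 h -> twice_derivable (h^~ t).
Proof.
move=> tt [ch [dh [[cDh [dDh _]] _]]]; split.
  apply/subspace_continuousP => x Rx.
  have xt : (q, t) @[q --> within (@Rplus R) (nbhs x)] -->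
      within (@Rplus R `*` @types R) (nbhs (x, t)).
    have qt : (q, t) @[q --> x] --> (x, t).
      exact: (cvg_pair cvg_id (cvg_cst t)).
    move=> S /= /qt; rewrite !nbhs_simpl /=.
    by apply: filterS => q /= + Rq; apply; split.
  have := (subspace_continuousP _ _).1 ch (x, t) (conj Rx tt).
  exact: cvg_comp xt.
move=> x x0; have Rx := nbhs_Rplus x0; have Rx' := nbhs_singleton Rx.
split; apply: derivable_in_is_derive => //.
  exact: (dh _ _ Rx' tt).1.
exact: (dDh _ _ Rx' tt).1.
Qed.

Lemma second_difference_twice_derivable g x d : twice_derivable g ->
  0 < d -> d <= x ->
  exists e c, [/\ 0 < e, 0 < c &
    g (x + d) - g x = g x - g (x - d) + D (D g) c * e].
Proof.
move=> dg d0 dx.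
have [|||s [e [c [e0 c0 sl sr]]]] :=
  @slopes_twice_derivable g (x - d) x (x + d) dg.
- by rewrite subr_ge0.
- by rewrite ltrBlDr ltrDl.
- by rewrite ltrDl.
(* Both steps have length [d], so the gap [D (D g) c * e] between the slopes is multiplied by
   [d]. *)
exists (e * d), c; split; rewrite ?mulr_gt0//.
by rewrite sr sl; ring.
Qed.

(** For [a > 0], nonnegativity and [g 0 = 0] make the slope over [[0, a]] nonnegative, and strict
    convexity makes the slope over [[a, b]] strictly larger. *)
Lemma convex_ge0_increasing g a b : twice_derivable g ->
  (forall q, 0 < q -> 0 < D (D g) q) -> g 0 = 0 ->
  (forall q, 0 < q -> 0 <= g q) -> 0 <= a -> a < b -> g a < g b.
Proof.
move=> dg g2 g00 g0 a0 ab.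
wlog a_gt0 : a ab a0 / 0 < a => [hwlog|].
  have [a_gt0|a_le0] := ltP 0 a; first exact: hwlog.
  have -> : a = 0 by apply/eqP; rewrite eq_le a_le0 a0.
  have b0 : 0 < b by exact: le_lt_trans ab.
  (* For [a = 0], pass through the midpoint: [0 <= g (b / 2) < g b]. *)
  by rewrite g00 (le_lt_trans (g0 (b / 2) _)) ?hwlog; lra.
have [|||s [e [c [e0 c0 sl sr]]]] :=
  @slopes_twice_derivable g 0 a b dg => //.
rewrite g00 !subr0 in sl.
have s0 : 0 <= s by rewrite -(pmulr_lge0 _ a_gt0) -sl g0.
rewrite -subr_gt0 sr mulr_gt0 ?subr_gt0// ltr_wpDl// mulr_gt0//.
exact: g2.
Qed.

Lemma argmax_decreasing (V P I : R -> R) (v w p q : R) :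
  twice_derivable V -> twice_derivable P -> twice_derivable I ->
  (forall x, 0 < x -> D (D V) x <= 0) ->
  (forall x, 0 < x -> 0 < D (D P) x) ->
  (forall x, 0 < x -> 0 < D (D I) x) ->
  I 0 = 0 -> (forall x, 0 < x -> 0 <= I x) ->
  0 <= v <= w -> 0 <= p -> 0 <= q ->
  (forall x, 0 <= x -> V x - P x - v * I x <= V p - P p - v * I p) ->
  (forall x, 0 <= x -> V x - P x - w * I x <= V q - P q - w * I q) ->
  q <= p.
Proof.
move=> dV dP dI V2 P2 I2 I00 I0 /andP[v0 vw] p0 q0 maxp maxq.
rewrite leNgt; apply/negP => pq.
have Ipq : I p < I q by exact: convex_ge0_increasing.
have {}vw : v = w.
  apply/eqP; rewrite eq_le vw /= leNgt; apply/negP => {}vw.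
  have : 0 < (w - v) * (I q - I p) by rewrite mulr_gt0// subr_gt0.
  have := maxp q q0; have := maxq p p0; lra.
subst w.
(* With equal weights, [p] and [q] maximize the same objective; strict concavity makes the midpoint
   [x] beat their average. The strictness comes from [P], since the weight [v] may be 0. *)
pose x := (p + q) / 2; pose d := (q - p) / 2.
have d0 : 0 < d by rewrite /d; lra.
have dx : d <= x by rewrite /d /x; lra.
have xdp : x - d = p by rewrite /d /x; field.
have xdq : x + d = q by rewrite /d /x; field.
have [e1 [c1 [e10 /V2 V1]]] := second_difference_twice_derivable dV d0 dx.
have [e2 [c2 [e20 /P2 P1]]] := second_difference_twice_derivable dP d0 dx.
have [e3 [c3 [e30 /I2 I1]]] := second_difference_twice_derivable dI d0 dx.
rewrite xdp xdq => EI EP EV.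
have {}EV : V q - V x <= V x - V p.
  by rewrite EV gerDl mulr_le0_ge0 // ltW.
have {}EP : P q - P x > P x - P p by rewrite EP ltrDl mulr_gt0.
have {}EI : 0 <= v * ((I q - I x) - (I x - I p)).
  by rewrite mulr_ge0// EI [_ + _ * e3]addrC addrK mulr_ge0 ?ltW.
have x0 : 0 <= x by rewrite /x; lra.
have := maxp x x0; have := maxq x x0; lra.
Qed.

End ConvexOnRplus.

(** * Weights, virtual costs and the quality function *)

Section QualityFunction.
Context {R : realType}.
Implicit Types (V F f : R -> R) (C CP CI : R -> R -> R) (B : set R) (q t : R).

Lemma cdf_itv F f t : type_distribution F f -> 0 <= t < 1 -> 0 <= F t < 1.
Proof.
move=> [[cf _] f0 Ff F1] /andP[t0 t1].
have intf : lebesgue_measure.-integrable `[0, 1] (EFin \o f).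
  by apply: continuous_compact_integrable => //; exact: segment_compact.
apply/andP; split.
  rewrite Ff ?t0 ?(ltW t1)//; apply: Rintegral_ge0 => x /=.
  rewrite in_itv/= => /andP[x0 xt]; apply/ltW/f0.
  by rewrite x0 (le_trans xt) ?ltW.
rewrite -F1 !Ff ?ler01 ?lexx ?t0 ?(ltW t1)// -subr_gt0 Rintegral_itvB//;
  last exact: ltW.
(* [1 - F t] is the integral of [f] over []t, 1]], hence at least [(1 - t)] times the positive
   minimum [f c] of the density. *)
have [c c01 fc] := EVT_min ler01 cf.
have sub : `]t, 1] `<=` (`[0, 1] : set R).
  by move=> x /=; rewrite !in_itv/= => /andP[/ltW/(le_trans t0)-> ->].
have intS (h : R -> R) : lebesgue_measure.-integrable `[0, 1] (EFin \o h) ->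
    lebesgue_measure.-integrable `]t, 1] (EFin \o h) by exact: integrableS.
have mu1 : fine (@lebesgue_measure R `]t, 1]) = 1 - t.
  by rewrite lebesgue_measure_itv/= lte_fin t1 -EFinB.
apply: (@lt_le_trans _ _ (\int[lebesgue_measure]_(x in `]t, 1]) (f c))).
  by rewrite Rintegral_cst// mu1 mulr_gt0 ?subr_gt0// f0// -in_itv.
apply: le_Rintegral => //.
- apply/intS/continuous_compact_integrable; first exact: segment_compact.
  by move=> ?; exact: cvg_cst.
- exact: intS.
- by move=> x /sub; exact: fc.
Qed.

(** Serves at [q = 0]: since the investment cost vanishes there for all interior types, so does the
    information-rent term of the virtual cost. *)
Lemma D_t_eq0 C q t : (forall s, 0 < s < 1 -> C q s = 0) -> 0 < t < 1 ->
  D_t C q t = 0.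
Proof.
move=> C0 /andP[t0 t1]; apply: is_derive_derive_in.
  near=> s; rewrite /types/= in_itv/=; apply/andP; split.
    by near: s; exact: lt_le_nbhsr.
  by near: s; exact: lt_le_nbhsl.
apply: (@near_eq_is_derive _ _ _ (cst 0)).
near=> s; rewrite C0//; apply/andP; split.
  by near: s; exact: lt_nbhsr.
by near: s; exact: lt_nbhsl.
Unshelve. all: by end_near. Qed.

Lemma twice_derivable_virtual C F f t : Ck2 3 C -> 0 < t < 1 ->
  twice_derivable (virtual C F f ^~ t).
Proof.
move=> C3 /andP[t0 t1].
have tt : types t by rewrite /types/= in_itv/= !ltW.
apply: (@twice_derivableDM _ (C^~ t) (D_t C ^~ t)).
  exact: (twice_derivable_Ck2 tt C3).
(* One of the three orders of smoothness is spent on the derivative in the type; two remain for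
   [q]. *)
by case: C3 => _ [_ [_ DC2]]; exact: (@twice_derivable_Ck2 _ 0 _ _ tt DC2).
Qed.

Lemma qsym_decreasing_interior V CP CI F f B n m b c (p q : R -> R) t :
  standing_assumptions V CP CI F f B ->
  is_qsym V CP CI F f n b p -> is_qsym V CP CI F f m c q -> 0 < t < 1 ->
  0 <= b / (1 - F t) ^+ n.-1 <= c / (1 - F t) ^+ m.-1 -> q t <= p t.
Proof.
move=> [dist V2 _ VDD hP hI CI0 _ _ _] [maxp _] [maxq _] t01 bc.
have t01' : 0 <= t < 1 by case/andP: t01 => /ltW-> ->.
have tle : 0 <= t <= 1 by case/andP: t01 => /ltW-> /ltW->.
have [p0 {}maxp] := maxp t t01'; have [q0 {}maxq] := maxq t t01'.
have k0 : 0 <= F t / f t.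
  have /andP[F0 _] := cdf_itv dist t01'.
  by rewrite divr_ge0// ltW// (density_gt0 dist).
apply: (argmax_decreasing _ _ _ _ _ _ _ _ bc p0 q0 maxp maxq).
- exact: twice_derivable_Ck1.
- by apply: twice_derivable_virtual => //; exact: cost_smooth hP.
- by apply: twice_derivable_virtual => //; exact: cost_smooth hI.
- exact: VDD.
- by move=> x x0; exact: (virtual_qq hP).
- by move=> x x0; exact: (virtual_qq hI).
- rewrite /virtual (CI0 t t01).1 D_t_eq0 ?mul0r ?addr0//.
  by move=> s /CI0[].
- move=> x x0; apply: addr_ge0.
    by apply: (cost_ge0 hI) => //; exact: ltW.
  by apply: mulr_ge0 => //; apply/ltW/(cost_t hI).
Qed.

(** Stated through the order of the weights, so that a change in the number of firms and a change in
    the scale are both instances. *)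
Lemma qsym_decreasing V CP CI F f B n m b c (p q : R -> R) t :
  standing_assumptions V CP CI F f B ->
  is_qsym V CP CI F f n b p -> is_qsym V CP CI F f m c q ->
  (forall s, 0 < s < 1 ->
    0 <= b / (1 - F s) ^+ n.-1 <= c / (1 - F s) ^+ m.-1) ->
  0 <= t < 1 -> q t <= p t.
Proof.
move=> hyp hp hq bc /andP[t0 t1].
have int s : 0 < s < 1 -> q s <= p s.
  move=> s01.
  exact: (qsym_decreasing_interior hyp hp hq s01 (bc s s01)).
have [t_gt0|t_le0] := ltP 0 t; first by apply: int; rewrite t_gt0.
have -> : t = 0 by apply/eqP; rewrite eq_le t_le0 t0.
(* The weak inequality at interior types passes to the right limits at 0, which are [q 0] and
   [p 0]. *)
apply: (ler_cvg_to hq.2 hp.2); near=> s; apply: int; apply/andP; split.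
  by near: s; exact: nbhs_right_gt.
by near: s; exact: nbhs_right_lt.
Unshelve. all: by end_near. Qed.

End QualityFunction.

(** * Monotonicity in the number of firms and in the scale *)

Theorem proposition4 (R : realType) (V : R -> R) (CP CI : R -> R -> R)
    (F f : R -> R) (B : set R)
    (hyp : standing_assumptions V CP CI F f B)
    (qsym : nat -> R -> R -> R)
    (qsymP : forall (n : nat) (b : R), (0 < n)%N -> B b ->
       is_qsym V CP CI F f n b (qsym n b))
    (t : R) (ht : 0 <= t < 1) :
  (forall (b : R) (n m : nat), B b -> (0 < n)%N -> (n <= m)%N ->
     qsym m b t <= qsym n b t) /\
  (forall (n : nat) (b c : R), (0 < n)%N -> B b -> B c -> b <= c ->
     qsym n c t <= qsym n b t).
Proof.
have F1 s : 0 < s < 1 -> 0 < 1 - F s <= 1.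
  move=> /andP[s0 s1]; rewrite subr_gt0 gerBl andbC.
  by apply: (cdf_itv (f := f)); [case: hyp|rewrite ltW].
have B0 := scale_ge0 hyp.
split=> [b n m Bb n0 nm|n b c n0 Bb Bc bc].
  have m0 := leq_trans n0 nm.
  apply: (qsym_decreasing hyp (qsymP _ _ n0 Bb)
    (qsymP _ _ m0 Bb) _ ht) => s /F1/andP[Fs0 Fs1].
  rewrite divr_ge0 ?exprn_ge0 ?(B0 b) ?(ltW Fs0)//=.
  apply: ler_wpM2l; first exact: B0.
  (* As [1 - F s] lies in []0, 1]], a larger exponent gives a smaller power and a larger weight. *)
  rewrite lef_pV2 ?posrE ?exprn_gt0// ler_wiXn2l ?(ltW Fs0)//.
  by rewrite -!subn1 leq_sub2r.
apply: (qsym_decreasing hyp (qsymP _ _ n0 Bb)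
  (qsymP _ _ n0 Bc) _ ht) => s /F1/andP[Fs0 Fs1].
rewrite divr_ge0 ?exprn_ge0 ?(B0 b) ?(ltW Fs0)//=; apply: ler_wpM2r => //.
by rewrite invr_ge0 exprn_ge0 ?(ltW Fs0).
Qed.
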